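(* For every ribbon graph (embedded graph) $G$ there exist a partition $E(G)=A_1\cup\dots\cup A_6$ (parts possibly empty) such that the twisted dual $G^{\prod_{i=1}^6 \xi_i(A_i)}$ is checkerboard colourable, where $\xi_1,\dots,\xi_6$ are the six elements of $\mathcal{B}=\langle \delta,\tau\mid \delta^2,\tau^2,(\delta\tau)^3\rangle$. In other words, every embedded graph has a checkerboard colourable twisted dual.
   Context: A ribbon graph $G$ is a (possibly non-orientable) surface with boundary, written as a union of vertex discs $V(G)$ and edge discs $E(G)$, such that vertices and edges meet in disjoint line segments, each such segment lies on the boundary of exactly one vertex and one edge, and every edge contains exactly two such segments. Ribbon graphs are equivalent to cellularly embedded graphs; the faces are the boundary components of the ribbon graph. For an edge $e$, deleting its two vertex–edge intersection segments from $\partial e$ leaves two arcs (the edge line segments of $e$), each lying on a boundary component. $G$ is checkerboard colourable if the faces (boundary components) can be coloured red/blue so that for every edge, the faces containing its two edge line segments receive different colours. For $A\subseteq E(G)$: the partial Petrial $G^{\tau(A)}$ is obtained by adding a half-twist to each edge of $A$. The partial dual $G^{\delta(A)}=G^A$ is defined via arrow presentations: $G$ is represented by the boundary circles of its vertex discs carrying, for each edge $e$, two arrows labelled $e$ (on the two segments where $e$ meets vertices, directed consistently with a chosen orientation of $\partial e$); for each $e\in A$ with arrows $\alpha,\beta$, draw an arrowed segment from the head of $\alpha$ to the tail of $\beta$ and one from the head of $\beta$ to the tail of $\alpha$, label both $e$, and delete $\alpha,\beta$ and the arcs underlying them; the resulting arrow presentation determines $G^A$. The operations $\delta(A)$ and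 $\tau(A)$ generate an action of $\mathcal{B}=\langle \delta,\tau\mid \delta^2,\tau^2,(\delta\tau)^3\rangle$ on edge sets; a twisted dual of $G$ is a ribbon graph of the form $G^{\prod_{i=1}^6 \xi_i(A_i)}$ where the $A_i$ partition $E(G)$ and the $\xi_i$ are the six elements of $\mathcal{B}$. *)

(* Defs.v *)
From mathcomp Require Import all_boot.

Set Implicit Arguments.
Unset Strict Implicit.
Unset Printing Implicit Defensive.

(* Ribbon graphs are given by their arrow presentations.  Every edge e labels
   two arrows (e, false) and (e, true), placed on the two segments where the
   edge disc meets vertex discs and directed consistently with an orientation
   of the boundary of the edge disc.  (e, i, true) is the head of the arrow
   (e, i), and (e, i, false) is its tail. *)
Definition arrow_end (E : Type) : Type := (E * bool * bool)%type.

(* Removing the arrows from the circles leaves arcs, each joining two arrow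
   ends, and the circles that carry no arrow; [arc] sends an arrow end to the
   other end of its arc, and [isolated] counts the circles without arrows.
   Conversely, the circles carrying arrows (the boundaries of the vertex discs
   incident with an edge) are the closed curves that alternate between arrows
   and arcs.  The two ends of an arc may be the head and the tail of the same
   arrow: this is a vertex disc met by one edge segment only. *)
Record ribbon_graph (E : finType) := RibbonGraph {
  arc : arrow_end E -> arrow_end E;
  arcK : involutive arc;
  arc_neq : forall x, arc x != x;
  isolated : nat
}.

Section Faces.
Variables (E : finType) (G : ribbon_graph E).

(* As the arrows follow an orientation of the boundary of the edge disc, the
   two edge line segments of e run from the head of each arrow of e to the tail
   of the other one. *)
Definition across_edge (x : arrow_end E) : arrow_end E :=
  let: (e, i, h) := x in (e, ~~ i, ~~ h).

Definition boundary_step : rel (arrow_end E) :=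
  fun x y => (y == arc G x) || (y == across_edge x).

Definition boundary_of (x : arrow_end E) : {set arrow_end E} :=
  [set y | connect boundary_step x y].

(* A boundary component either contains arrow ends, and is identified with the
   set of these, or is the boundary of an isolated vertex disc. *)
Definition face : Type :=
  ({X : {set arrow_end E} | X \in [set boundary_of x | x : arrow_end E]}
   + 'I_(isolated G))%type.

Definition face_of (x : arrow_end E) : face :=
  inl (exist _ (boundary_of x) (imset_f boundary_of (erefl : x \in predT))).

(* The face containing the edge line segment of e that leaves the head of the
   arrow (e, i). *)
Definition edge_line_face (e : E) (i : bool) : face := face_of (e, i, true).

Definition checkerboard_colourable : Prop :=
  exists colour : face -> bool,
    forall e : E,
      colour (edge_line_face e false) <> colour (edge_line_face e true).

End Faces.

Section Relabel.
Variables (E : finType) (G : ribbon_graph E).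
Variables f g : arrow_end E -> arrow_end E.
Hypotheses (fK : cancel f g) (gK : cancel g f).

Fact relabel_arcK : involutive (g \o arc G \o f).
Proof. by move=> x; rewrite /= gK arcK fK. Qed.

Fact relabel_arc_neq x : (g \o arc G \o f) x != x.
Proof.
by apply/eqP => /= /(congr1 f); rewrite gK => /eqP; rewrite (negPf (arc_neq _ _)).
Qed.

(* New arrows on the same arcs: the end x of a new arrow is placed where the
   end f x of an old arrow was. *)
Definition relabel : ribbon_graph E :=
  RibbonGraph relabel_arcK relabel_arc_neq (isolated G).

End Relabel.

Section PartialDual.
Variables (E : finType) (A : {set E}).

(* For e in A, the new arrow (e, i) goes from the head of the old arrow (e, i)
   to the tail of the other old arrow of e. *)
Definition dual_end (x : arrow_end E) : arrow_end E :=
  let: (e, i, h) := x in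
  if e \in A then (if h then (e, ~~ i, false) else (e, i, true)) else x.

Definition dual_end_inv (x : arrow_end E) : arrow_end E :=
  let: (e, i, h) := x in
  if e \in A then (if h then (e, i, false) else (e, ~~ i, true)) else x.

Fact dual_endK : cancel dual_end dual_end_inv.
Proof.
by move=> [[e i] h] /=; case Ae: (e \in A); case: h; rewrite /= Ae ?negbK.
Qed.

Fact dual_end_invK : cancel dual_end_inv dual_end.
Proof.
by move=> [[e i] h] /=; case Ae: (e \in A); case: h; rewrite /= Ae ?negbK.
Qed.

Definition partial_dual (G : ribbon_graph E) : ribbon_graph E :=
  relabel G dual_endK dual_end_invK.

(* A half-twist in the edge e reverses one of its two arrows. *)
Definition twist_end (x : arrow_end E) : arrow_end E :=
  let: (e, i, h) := x in if (e \in A) && i then (e, i, ~~ h) else x.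

Fact twist_endK : involutive twist_end.
Proof.
by move=> [[e i] h] /=; case c: ((e \in A) && i); rewrite /= c ?negbK.
Qed.

Definition partial_petrial (G : ribbon_graph E) : ribbon_graph E :=
  relabel G twist_endK twist_endK.

End PartialDual.

Inductive generator := delta | tau.

(* As both generators are involutions, every element of the group
   < delta, tau | delta^2, tau^2, (delta tau)^3 > is represented by a word
   without inverses. *)
Definition word := seq generator.

Definition act_generator (E : finType) (A : {set E}) (a : generator) :
    ribbon_graph E -> ribbon_graph E :=
  match a with
  | delta => partial_dual A
  | tau => partial_petrial A
  end.

(* act w A G is G^(w(A)), a left action: the last letter of w acts first. *)
Definition act (E : finType) (w : word) (A : {set E}) (G : ribbon_graph E) :
    ribbon_graph E :=
  foldr (act_generator A) G w.

(* The six elements of the group; see xi_complete and xi_inj below. *)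
Definition xi (i : 'I_6) : word :=
  nth [::] [:: [::]; [:: delta]; [:: tau]; [:: delta; tau]; [:: tau; delta];
               [:: delta; tau; delta]] i.

Definition twisted_dual (E : finType) (A : 'I_6 -> {set E})
    (G : ribbon_graph E) : ribbon_graph E :=
  foldr (fun i => act (xi i) (A i)) G (enum 'I_6).

(* Equality of words in the presented group. *)
Inductive eqB : word -> word -> Prop :=
| eqB_refl u : eqB u u
| eqB_sym u v : eqB u v -> eqB v u
| eqB_trans u v w : eqB u v -> eqB v w -> eqB u w
| eqB_delta2 u v : eqB (u ++ [:: delta; delta] ++ v) (u ++ v)
| eqB_tau2 u v : eqB (u ++ [:: tau; tau] ++ v) (u ++ v)
| eqB_deltatau3 u v :
    eqB (u ++ [:: delta; tau; delta; tau; delta; tau] ++ v) (u ++ v).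

Lemma eqB_cons a u v : eqB u v -> eqB (a :: u) (a :: v).
Proof.
elim=> {u v} [u|u v _|u v w _ + _|u v|u v|u v].
- exact: eqB_refl.
- exact: eqB_sym.
- exact: eqB_trans.
- exact: (eqB_delta2 (a :: u)).
- exact: (eqB_tau2 (a :: u)).
- exact: (eqB_deltatau3 (a :: u)).
Qed.

Lemma eqB_braid v :
  eqB [:: tau, delta, tau & v] [:: delta, tau, delta & v].
Proof.
have s1 := eqB_sym (eqB_deltatau3 [::] [:: tau, delta, tau & v]).
have s2 := eqB_tau2 [:: delta; tau; delta; tau; delta] [:: delta, tau & v].
have s3 := eqB_delta2 [:: delta; tau; delta; tau] (tau :: v).
have s4 := eqB_tau2 [:: delta; tau; delta] v.
exact: eqB_trans (eqB_trans s1 s2) (eqB_trans s3 s4).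
Qed.

Lemma xi_complete w : exists i : 'I_6, eqB w (xi i).
Proof.
elim: w => [|a w [i wi]]; first by exists ord0; exact: eqB_refl.
suff [j ij] : exists j : 'I_6, eqB (a :: xi i) (xi j).
  by exists j; apply: eqB_trans ij; exact: eqB_cons.
have mk k (lt_k6 : k < 6) u : eqB u (xi (Ordinal lt_k6)) ->
  exists j : 'I_6, eqB u (xi j) by exists (Ordinal lt_k6).
case: a; case: i {wi} => [] [|[|[|[|[|[|//]]]]]] lt_i6; rewrite /xi /=.
- by apply: (mk 1 isT); exact: eqB_refl.
- by apply: (mk 0 isT); exact: (eqB_delta2 [::] [::]).
- by apply: (mk 3 isT); exact: eqB_refl.
- by apply: (mk 2 isT); exact: (eqB_delta2 [::] [:: tau]).
- by apply: (mk 5 isT); exact: eqB_refl.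
- by apply: (mk 4 isT); exact: (eqB_delta2 [::] [:: tau; delta]).
- by apply: (mk 2 isT); exact: eqB_refl.
- by apply: (mk 4 isT); exact: eqB_refl.
- by apply: (mk 0 isT); exact: (eqB_tau2 [::] [::]).
- by apply: (mk 5 isT); exact: eqB_braid.
- by apply: (mk 1 isT); exact: (eqB_tau2 [::] [:: delta]).
- apply: (mk 3 isT); apply: eqB_trans (eqB_delta2 [:: delta; tau] [::]).
  exact: eqB_braid.
Qed.

Lemma xi_inj i j : eqB (xi i) (xi j) -> i = j.
Proof.
pose act3 a (x : option bool) := match a, x with
  | delta, None => Some false | delta, Some false => None
  | tau, Some b => Some (~~ b) | _, _ => x end.
have eqB_act3 u v : eqB u v -> forall x, foldr act3 x u = foldr act3 x v.
  elim=> {u v} [//|u v _ IH x|u v w _ IHu _ IHv x|u v x|u v x|u v x].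
  - by rewrite IH.
  - by rewrite IHu.
  - by rewrite !foldr_cat /=; case: (foldr _ _ v) => [[]|].
  - by rewrite !foldr_cat /=; case: (foldr _ _ v) => [[]|].
  - by rewrite !foldr_cat /=; case: (foldr _ _ v) => [[]|].
move/eqB_act3 => eq_ij; apply/val_inj; move: (eq_ij None) (eq_ij (Some false)).
case: i {eq_ij} => [] [|[|[|[|[|[|//]]]]]] ?;
  by case: j => [] [|[|[|[|[|[|//]]]]]].
Qed.

(* Two arrow presentations determine the same ribbon graph when they differ by
   exchanging the names of the two arrows of some edges and by reversing both
   arrows of some edges (the other orientation of the boundary of the edge
   disc).  K e tells which of the two is done at e. *)
Definition rename (E : finType) (K : E -> bool * bool) (x : arrow_end E) :
    arrow_end E :=
  let: (e, i, h) := x in (e, i (+) (K e).1, h (+) (K e).2).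

Definition same_ribbon_graph (E : finType) (G H : ribbon_graph E) : Prop :=
  isolated G = isolated H /\
  exists K, forall x, arc H x = rename K (arc G (rename K x)).

Section SameRibbonGraph.
Variable E : finType.
Implicit Types (G H : ribbon_graph E) (A : {set E}).

Lemma renameK (K : E -> bool * bool) : involutive (rename K).
Proof. by case=> [[e i] h]; rewrite /= !addbK. Qed.

Lemma rename0 (x : arrow_end E) : rename (fun=> (false, false)) x = x.
Proof. by case: x => [[e i] h]; rewrite /= !addbF. Qed.

Lemma same_ribbon_graph_refl G : same_ribbon_graph G G.
Proof.
by split=> //; exists (fun=> (false, false)) => x; rewrite !rename0.
Qed.

Lemma same_ribbon_graph_sym G H :
  same_ribbon_graph G H -> same_ribbon_graph H G.
Proof. by case=> eqi [K eqa]; split=> //; exists K => x; rewrite eqa !renameK. Qed.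

Lemma same_ribbon_graph_trans G H J :
  same_ribbon_graph G H -> same_ribbon_graph H J -> same_ribbon_graph G J.
Proof.
case=> eqi [K eqa] [eqi' [L eqa']]; split; first by rewrite eqi.
pose M e := ((K e).1 (+) (L e).1, (K e).2 (+) (L e).2).
have ME x : rename M x = rename L (rename K x).
  by case: x => [[e i] h]; rewrite /= !addbA.
have MC x : rename M x = rename K (rename L x).
  case: x => [[e i] h]; rewrite /= !addbA.
  by rewrite (addbAC i) (addbAC h).
by exists M => x; rewrite eqa' eqa ME MC.
Qed.

Lemma act_generator_same A a G H :
  same_ribbon_graph G H ->
  same_ribbon_graph (act_generator A a G) (act_generator A a H).
Proof.
case=> eqi [K eqa]; case: a; split=> //=.
- exists (fun e => ((K e).1 (+) ((e \in A) && (K e).2), (K e).2)).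
  set L := fun e => _.
  have fL x : rename K (dual_end A x) = dual_end A (rename L x).
    case: x => [[e i] h]; rewrite /= /L /=; case Ae: (e \in A) => /=;
    by case: h; case: i => /=; case: (K e) => [[] []]; rewrite /= ?Ae.
  move=> x; rewrite /= eqa fL; move: (arc G _) => y.
  by rewrite -[RHS](dual_endK A) -fL dual_end_invK.
- exists (fun e => ((K e).1, (K e).2 (+) ((e \in A) && (K e).1))).
  set L := fun e => _.
  have fL x : rename K (twist_end A x) = twist_end A (rename L x).
    case: x => [[e i] h]; rewrite /= /L /=; case Ae: (e \in A) => /=;
    by case: h; case: i => /=; case: (K e) => [[] []]; rewrite /= ?Ae.
  move=> x; rewrite /= eqa fL; move: (arc G _) => y.
  by rewrite -[RHS](twist_endK A) -fL twist_endK.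
Qed.

Lemma act_same A w G H :
  same_ribbon_graph G H -> same_ribbon_graph (act w A G) (act w A H).
Proof. by move=> GH; elim: w => //= a w; exact: act_generator_same. Qed.

(* Up to these renamings, act is an action of the presented group. *)
Lemma act_eqB A u v G :
  eqB u v -> same_ribbon_graph (act u A G) (act v A G).
Proof.
have actD s t K : act (s ++ t) A K = act s A (act t A K).
  by rewrite /act foldr_cat.
have relP r b : let K e := (b && (e \in A), false) in
    (forall H, isolated (act r A H) = isolated H) ->
    (forall H x, arc (act r A H) x = rename K (arc H (rename K x))) ->
  forall s t, same_ribbon_graph (act (s ++ r ++ t) A G) (act (s ++ t) A G).
  move=> K iso_r arc_r s t; rewrite !actD; apply: act_same.
  apply: same_ribbon_graph_sym; split; first by rewrite iso_r.
  by exists K => x; rewrite arc_r.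
elim=> {u v} [u|u v _|u v w _ + _|||].
- exact: same_ribbon_graph_refl.
- exact: same_ribbon_graph_sym.
- exact: same_ribbon_graph_trans.
- apply: (relP _ true) => // H x /=.
  have dd y : dual_end A (dual_end A y) = rename (fun e => (e \in A, false)) y.
    case: y => [[e i] h] /=; case Ae: (e \in A).
      by case: i; case: h; rewrite /= Ae.
    by rewrite /= Ae !addbF.
  rewrite dd; set y := arc _ _; apply: (can_inj (@dual_endK _ A)).
  by apply: (can_inj (@dual_endK _ A)); rewrite !dual_end_invK dd renameK.
- by apply: (relP _ false) => // H x /=; rewrite !twist_endK !rename0.
- apply: (relP _ false) => // H x /=; rewrite !rename0.
  pose td y := twist_end A (dual_end A y).
  have td3 y : td (td (td y)) = y.
    case: y => [[e i] h]; rewrite /td /=; case Ae: (e \in A).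
      by case: i; case: h; do ?rewrite /= Ae.
    by do ?rewrite /= Ae.
  rewrite -!/(td _) td3; set y := arc _ _.
  by rewrite -[y in LHS]td3 /td !(twist_endK, dual_endK).
Qed.

End SameRibbonGraph.

(* Main.v *)
From mathcomp Require Import all_boot.
Require Import Defs.

Set Implicit Arguments.
Unset Strict Implicit.
Unset Printing Implicit Defensive.

(** Shrinking every edge to a 4-valent vertex turns the arcs of the arrow
    presentation into the edges of the medial graph, which all twisted duals of
    [G] share: a twisted duality only permutes the four half-edges at each
    vertex.  It is therefore enough to colour the arcs red and blue with two
    half-edges of each colour at every vertex, and then to choose at each vertex
    one of [1], [delta], [tau] so that the edge line segments join half-edges of
    equal colour.

    To find the colouring, orient the medial graph with two half-edges in and
    two out at every vertex, and pair the incoming half-edges and the outgoing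
    ones.  A closed curve following arcs and these pairs reverses the
    orientation at each arc, so it has an even number of arcs and can be
    coloured alternately. *)

Section InvolutionPair.
Variables (T : finType) (f g : T -> T).
Hypotheses (fK : involutive f) (gK : involutive g).
Hypotheses (f_neq : forall x, f x != x) (g_neq : forall x, g x != x).

Let h := f \o g.

Let h_inj : injective h.
Proof. by apply: inj_comp; apply: inv_inj. Qed.

(* The group generated by f and g is dihedral, and its reflections, being
   conjugate to f or to g, have no fixed point. *)
Let iter_neq k x : iter k h x != f x.
Proof.
(* Passing from [y] to [h y] lowers the exponent by two, so two consecutive exponents are
   carried. *)
suff step : forall n y, (iter n h y != f y) && (iter n.+1 h y != f y).
  by case/andP: (step k x).
have fh y : h (f (h y)) = f y by rewrite /h /= fK gK.
elim=> [|n IHn] y.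
  rewrite /= eq_sym f_neq /=; apply/eqP => /(inv_inj fK) /eqP.
  by rewrite (negPf (g_neq y)).
case/andP: (IHn y) => _ -> /=.
apply/eqP; rewrite -fh => /h_inj; rewrite -iterS iterSr => /eqP.
by case/andP: (IHn (h y)) => /negPf ->.
Qed.

(** By [iter_neq], [f] sends each [h]-orbit to a different one, and [g x] lies in the orbit of
    [f x]; comparing the ranks of the two orbits colours [x]. *)
Lemma involution_pair_colouring :
  exists c : T -> bool,
    (forall x, c (f x) = ~~ c x) /\ (forall x, c (g x) = ~~ c x).
Proof.
have hC := fconnect_sym h_inj.
pose r x : nat := enum_rank (froot h x).
have r_neq x : r x != r (f x).
  apply/eqP => /val_inj /enum_rank_inj /eqP.
  by rewrite root_connect // => /iter_findex /eqP; apply/negP/iter_neq.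
have rh x : r (h x) = r x.
  congr (val (enum_rank _)); apply/esym/eqP.
  by rewrite root_connect // fconnect1.
have rg x : r (g x) = r (f x) by rewrite -rh /h /= gK.
have flip x : (r (f x) < r x) = ~~ (r x < r (f x)).
  by rewrite -leqNgt ltn_neqAle eq_sym r_neq.
exists (fun x => r x < r (f x)); split=> x; first by rewrite fK flip.
by rewrite rg -[f (g x)]/(h x) rh flip.
Qed.

End InvolutionPair.

Section MedialColouring.
Variables (E : finType) (G : ribbon_graph E).

Definition flip_end (x : arrow_end E) : arrow_end E :=
  let: (e, i, h) := x in (e, i, ~~ h).

Lemma balanced_arc_colouring :
  exists c : arrow_end E -> bool,
    (forall x, c (arc G x) = c x) /\
    (forall e, exists b, forall h, c (e, true, h) = ~~ c (e, false, h (+) b)).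
Proof.
have flipK : involutive flip_end by case=> [[e i] h] /=; rewrite negbK.
have flip_neq x : flip_end x != x.
  by case: x => [[e i] h]; rewrite !xpair_eqE; case: h; rewrite andbF.
have [o [oG oM]] :=
  involution_pair_colouring (@arcK _ G) flipK (@arc_neq _ G) flip_neq.
have {}oM e i h : o (e, i, ~~ h) = ~~ o (e, i, h) by rewrite -oM.
(* [b e] records whether the two heads at [e] are oriented oppositely, so that [N] pairs ends of
   equal orientation. *)
pose b e := o (e, true, true) != o (e, false, true).
have ob e i h : o (e, ~~ i, h (+) b e) = o (e, i, h).
  have oT j k : o (e, j, k) = o (e, j, true) (+) ~~ k.
    by case: k; [rewrite addbF | rewrite (oM e j true) addbT].
  rewrite oT [RHS]oT /b.
  by case: i; case: h; do 2?case: (o _).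
pose N (x : arrow_end E) := let: (e, i, h) := x in (e, ~~ i, h (+) b e).
have NK : involutive N by case=> [[e i] h] /=; rewrite negbK addbK.
have N_neq x : N x != x.
  by case: x => [[e i] h]; rewrite !xpair_eqE; case: i; rewrite andbF.
have oN x : o (N x) = o x by case: x => [[e i] h]; exact: ob.
have [c [cG cN]] :=
  involution_pair_colouring (@arcK _ G) NK (@arc_neq _ G) N_neq.
(* Both [c] and [o] change along arcs, but only [c] changes along [N]. *)
exists (fun x => c x (+) o x); split=> [x|e].
  by rewrite cG oG addNb addbN negbK.
exists (b e) => h.
by rewrite -[(e, false, _)]/(N (e, true, h)) cN oN addNb negbK.
Qed.

Lemma checkerboard_of_end_colouring (c : arrow_end E -> bool) :
    (forall x, c (arc G x) = c x) ->
    (forall x, c (across_edge x) = c x) ->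
    (forall e, c (e, false, true) <> c (e, true, true)) ->
  checkerboard_colourable G.
Proof.
move=> cG cA c_neq.
have c_conn x y : connect (boundary_step G) x y -> c y = c x.
  case/connectP => p.
  elim: p x => [x _ -> //|z p IHp x /= /andP[xz zp] /(IHp _ zp) ->].
  by case/orP: xz => /eqP ->.
(* Isolated discs carry no edge line segment, so their colour is arbitrary. *)
exists (fun F : face G =>
  if F is inl X then [exists y in sval X, c y] else false) => e.
have cF i : [exists y in boundary_of G (e, i, true), c y] = c (e, i, true).
  apply/existsP/idP => [[y]|ce].
    by rewrite inE => /andP[/c_conn ->].
  by exists (e, i, true); rewrite inE connect0.
by rewrite /= !cF.
Qed.

End MedialColouring.

Definition generator_end (E : finType) (A : {set E}) (a : generator) :
    arrow_end E -> arrow_end E :=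
  match a with delta => dual_end A | tau => twist_end A end.

(** The first letter acts last on [G], so it relabels ends first: hence [foldl]. *)
Definition word_end (E : finType) (A : {set E}) (w : word) (x : arrow_end E) :
    arrow_end E :=
  foldl (fun y a => generator_end A a y) x w.

Definition twisted_dual_end (E : finType) (A : 'I_6 -> {set E})
    (x : arrow_end E) : arrow_end E :=
  foldl (fun y i => word_end (A i) (xi i) y) x (enum 'I_6).

Section TwistedDualEnd.
Variable E : finType.
Implicit Type G : ribbon_graph E.

Lemma generator_end_arc (A : {set E}) a G x :
  generator_end A a (arc (act_generator A a G) x) =
  arc G (generator_end A a x).
Proof. by case: a => /=; rewrite ?dual_end_invK ?twist_endK. Qed.

Lemma word_end_arc (A : {set E}) w G x :
  word_end A w (arc (act w A G) x) = arc G (word_end A w x).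
Proof.
elim: w x => //= a w IHw x.
by rewrite /word_end /= generator_end_arc; exact: IHw.
Qed.

Lemma twisted_dual_end_arc (A : 'I_6 -> {set E}) G x :
  twisted_dual_end A (arc (twisted_dual A G) x) =
  arc G (twisted_dual_end A x).
Proof.
rewrite /twisted_dual /twisted_dual_end; elim: (enum _) x => //= i s IHs x.
by rewrite word_end_arc IHs.
Qed.

Lemma twisted_dual_endE (k : E -> 'I_6) e i h :
  twisted_dual_end (fun j => [set e' | k e' == j]) (e, i, h) =
  word_end setT (xi (k e)) (e, i, h).
Proof.
have gen_edge A a i' h' :
    exists i1 h1, generator_end A a (e, i', h') = (e, i1, h1).
  by case: a => /=; case: ifP => _; case: h'; do 2!eexists; reflexivity.
have word_edge A w i' h' :
    exists i1 h1, word_end A w (e, i', h') = (e, i1, h1).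
  elim: w i' h' => [|a w IHw] i' h'; first by exists i', h'.
  rewrite /word_end /=; have [i1 [h1 ->]] := gen_edge A a i' h'.
  exact: IHw.
have word_in (A : {set E}) w i' h' : e \in A ->
    word_end A w (e, i', h') = word_end setT w (e, i', h').
  move=> Ae; elim: w i' h' => [//|a w IHw] i' h'; rewrite /word_end /=.
  have -> : generator_end A a (e, i', h') = generator_end setT a (e, i', h').
    by case: a => /=; rewrite Ae inE.
  by have [i1 [h1 ->]] := gen_edge setT a i' h'; exact: IHw.
have word_out (A : {set E}) w i' h' : e \notin A ->
    word_end A w (e, i', h') = (e, i', h').
  move=> /negPf Ae; rewrite /word_end; elim: w => //= a w IHw.
  by case: a => /=; rewrite Ae.
rewrite /twisted_dual_end.
have [] := (enum_uniq 'I_6, mem_enum 'I_6 (k e)); rewrite inE.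
have out s i' h' : k e \notin s ->
    foldl (fun y j => word_end [set e' | k e' == j] (xi j) y) (e, i', h') s =
    (e, i', h').
  elim: s => //= j s IHs; rewrite inE negb_or => /andP[kj ks].
  by rewrite word_out ?inE // IHs.
elim: (enum 'I_6) i h => //= j s IHs i h /andP[js us]; rewrite inE.
case: eqVneq => [kj _|kj /= ks]; last by rewrite word_out ?inE // IHs.
rewrite word_in ?inE ?kj //.
have [i1 [h1 ->]] := word_edge setT (xi j) i h.
by rewrite out // kj.
Qed.

End TwistedDualEnd.

Theorem theorem1 (E : finType) (G : ribbon_graph E) :
  exists A : 'I_6 -> {set E},
    [/\ (forall i j : 'I_6, i != j -> [disjoint A i & A j]),
        \bigcup_(i < 6) A i = [set: E]
      & checkerboard_colourable (twisted_dual A G)].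
Proof.
have [c [cG c_bal]] := balanced_arc_colouring G.
(* xi 1 is delta and xi 2 is tau. *)
pose k e : 'I_6 :=
  if c (e, false, true) == c (e, false, false) then @Ordinal 6 1 isT
  else if c (e, false, true) == c (e, true, true) then @Ordinal 6 2 isT
  else ord0.
exists (fun j => [set e | k e == j]); split=> [i j neq_ij||].
- rewrite disjoints_subset; apply/subsetP => e; rewrite !inE => /eqP ->.
  exact: neq_ij.
- by apply/setP => e; rewrite inE; apply/bigcupP; exists (k e); rewrite ?inE.
set A := fun j => _.
(* Exactly one other end at [e] has the colour of [(e, false, true)]. Edge line segments join the
   two after [delta] if it is the tail of the same arrow, after [tau] if it is the other head, and
   already in [G] otherwise. *)
have kE e : let c' i h := c (twisted_dual_end A (e, i, h)) in
    (forall i h, c' (~~ i) (~~ h) = c' i h) /\ c' false true <> c' true true.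
  have [b cb] := c_bal e.
  move: (cb true) (cb false); rewrite /=.
  case c1: (c (e, true, true)); case c2: (c (e, true, false));
  case c3: (c (e, false, true)); case c4: (c (e, false, false));
  case: b {cb}; rewrite /= ?c3 ?c4 // => _ _;
  split=> [[] []|]; rewrite !twisted_dual_endE /k ?c1 ?c3 ?c4 /word_end /=;
  by rewrite ?inE /= ?inE /= ?c1 ?c2 ?c3 ?c4.
apply: (checkerboard_of_end_colouring (c := c \o twisted_dual_end A)).
- by move=> x /=; rewrite twisted_dual_end_arc cG.
- by case=> [[e i] h]; case: (kE e) => + _; exact.
- by move=> e; case: (kE e).
Qed.
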